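(* Let $c_1,c_2\in(0,1]$ and $k\in(0,1)$ with $k>1-\frac{1}{4c_1}$. Let $(x_0,y_0)\in[-1,1]^2$ and define, for $n\ge 0$, $$x_{n+1}=c_1(1-2x_n^2),\qquad y_{n+1}=(1-k)c_2(1-2y_n^2)+k\,c_1(1-2x_n^2).$$ Then $$\limsup_{n\to\infty}|x_n-y_n|\le W_\infty(k),\qquad\text{where } W_\infty(k):=\frac{|c_1-c_2|(1-k)}{1-4c_1(1-k)},$$ and $\lim_{k\to1^-}W_\infty(k)=0$.
   Context: The system is a skew product (''master/slave'' coupling) of two logistic maps on $[-1,1]$ with coupling strength $k$; both sequences remain in $[-1,1]$. *)

(* Defs.v *)
From Stdlib Require Import Reals.
From Coquelicot Require Import Coquelicot.
Open Scope R_scope.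

Definition W_infty (c1 c2 k : R) : R :=
  Rabs (c1 - c2) * (1 - k) / (1 - 4 * c1 * (1 - k)).

(* Main.v *)
Require Import Defs.
From Stdlib Require Import Reals Lra.
From Coquelicot Require Import Coquelicot.
Open Scope R_scope.

(** Writing [e n = |x n - y n|], the splitting
    [c1 (1 - 2 x^2) - c2 (1 - 2 y^2) = (c1 - c2) (1 - 2 y^2) - 2 c1 (x - y) (x + y)]
    on [[-1, 1]] gives [e (n+1) <= 4 c1 (1 - k) e n + |c1 - c2| (1 - k)]. The hypothesis on [k]
    says that [4 c1 (1 - k) < 1], and [W_infty] is the fixed point of this affine contraction. *)

(** Measured from the fixed point [w] of [t => q * t + b], the upper bound shrinks by a factor [q]
    at each step, leaving a geometric term that vanishes. *)
Lemma LimSup_affine_contraction (q b : R) (e : nat -> R) :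
  0 <= q < 1 -> (forall n, e (S n) <= q * e n + b) ->
  Rbar_le (LimSup_seq e) (Finite (b / (1 - q))).
Proof.
intros Hq He.
set (w := b / (1 - q)).
assert (Hw : q * w + b = w) by (unfold w; field; lra).
assert (Hle : forall n, e n <= w + (e 0%nat - w) * q ^ n).
{ induction n as [|n IH]; [simpl; lra|].
  specialize (He n); simpl; nra. }
assert (Hlim : is_lim_seq (fun n => w + (e 0%nat - w) * q ^ n) (Finite w)).
{ replace (Finite w) with (Finite (w + (e 0%nat - w) * 0)) by (f_equal; ring).
  apply is_lim_seq_plus'; [apply is_lim_seq_const|].
  apply (is_lim_seq_scal_l _ (e 0%nat - w) (Finite 0)).
  apply is_lim_seq_geom; rewrite Rabs_pos_eq; lra. }
rewrite <- (is_LimSup_seq_unique _ _ (is_lim_LimSup_seq _ _ Hlim)).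
apply LimSup_le; exists 0%nat; auto.
Qed.

Lemma logistic_bound (c t : R) :
  0 <= c <= 1 -> -1 <= t <= 1 -> -1 <= c * (1 - 2 * t ^ 2) <= 1.
Proof. intros Hc Ht; assert (0 <= t ^ 2 <= 1) by nra; nra. Qed.

Lemma logistic_diff_le (c1 c2 s t : R) :
  0 <= c1 -> -1 <= s <= 1 -> -1 <= t <= 1 ->
  Rabs (c1 * (1 - 2 * s ^ 2) - c2 * (1 - 2 * t ^ 2))
    <= 4 * c1 * Rabs (s - t) + Rabs (c1 - c2).
Proof.
intros Hc1 Hs Ht.
(* Pairing [c1] with the difference of squares keeps [c2] out of the contraction factor; [4 * c1]
   then comes from [Rabs (s + t) <= 2]. *)
replace (c1 * (1 - 2 * s ^ 2) - c2 * (1 - 2 * t ^ 2))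
  with (- (2 * c1) * (s + t) * (s - t) + (c1 - c2) * (1 - 2 * t ^ 2)) by ring.
eapply Rle_trans; [apply Rabs_triang|].
rewrite !Rabs_mult, Rabs_Ropp, (Rabs_pos_eq (2 * c1)) by lra.
assert (Rabs (s + t) <= 2) by (apply Rabs_le; lra).
assert (Rabs (1 - 2 * t ^ 2) <= 1) by (apply Rabs_le; nra).
assert (H1 := Rabs_pos (s - t)); assert (H2 := Rabs_pos (c1 - c2)).
apply Rplus_le_compat; [|nra].
apply Rmult_le_compat_r; nra.
Qed.

(** At [k = 1] the denominator is 1 and the numerator 0, so continuity there suffices. *)
Lemma W_infty_at_left_1 (c1 c2 : R) :
  filterlim (W_infty c1 c2) (at_left 1) (locally 0).
Proof.
assert (H : continuous (W_infty c1 c2) 1).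
{ apply (ex_derive_continuous (W_infty c1 c2)); unfold W_infty.
  generalize (Rabs (c1 - c2)); intro d; auto_derive; lra. }
replace 0 with (W_infty c1 c2 1) by (unfold W_infty; field; lra).
apply filterlim_filter_le_1 with (2 := H).
apply filter_le_within.
Qed.

Theorem mainTheorem1 (c1 c2 k : R) (x y : nat -> R)
  (hc1 : 0 < c1 <= 1) (hc2 : 0 < c2 <= 1)
  (hk : 0 < k < 1) (hkc : k > 1 - 1 / (4 * c1))
  (hx0 : -1 <= x 0%nat <= 1) (hy0 : -1 <= y 0%nat <= 1)
  (hx : forall n : nat, x (S n) = c1 * (1 - 2 * x n ^ 2))
  (hy : forall n : nat,
      y (S n) = (1 - k) * c2 * (1 - 2 * y n ^ 2) + k * c1 * (1 - 2 * x n ^ 2)) :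
  Rbar_le (LimSup_seq (fun n => Rabs (x n - y n))) (Finite (W_infty c1 c2 k)) /\
  filterlim (fun k' => W_infty c1 c2 k') (at_left 1) (locally 0).
Proof.
split; [|apply W_infty_at_left_1].
assert (Hxy : forall n, -1 <= x n <= 1 /\ -1 <= y n <= 1).
{ induction n as [|n [IHx IHy]]; [tauto|].
  assert (Hx := logistic_bound c1 (x n) ltac:(lra) IHx).
  assert (Hy := logistic_bound c2 (y n) ltac:(lra) IHy).
  (* [y (S n)] is a convex combination, with weights [1 - k] and [k], of two logistic values in
     [-1, 1]. *)
  rewrite hx, hy, !Rmult_assoc; split; [lra|nra]. }
assert (Hq : 4 * c1 * (1 - k) < 1).
{ replace 1 with (4 * c1 * (1 / (4 * c1))) at 2 by (field; lra).
  apply Rmult_lt_compat_l; lra. }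
(* Unfolding [W_infty] gives [q = 4 * c1 * (1 - k)] and [b = Rabs (c1 - c2) * (1 - k)]. *)
apply LimSup_affine_contraction; [split; [nra|assumption]|].
intro n; destruct (Hxy n) as [Hxn Hyn].
(* The coupling term is [k * x (S n)], so subtraction leaves [1 - k] times the difference of the
   uncoupled maps. *)
replace (x (S n) - y (S n))
  with ((1 - k) * (c1 * (1 - 2 * x n ^ 2) - c2 * (1 - 2 * y n ^ 2)))
  by (rewrite hx, hy; ring).
rewrite Rabs_mult, (Rabs_pos_eq (1 - k)) by lra.
assert (H := logistic_diff_le c1 c2 (x n) (y n) ltac:(lra) Hxn Hyn).
apply (Rmult_le_compat_l (1 - k)) in H; lra.
Qed.
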